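(* Let $M^n$ ($n\ge 2$) be a hypersurface immersed in a Riemannian manifold $(\bar M^{n+1},\bar g)$ and equipped with an $s$-dimensional foliation $\mathcal F$ ($1\le s\le n$), and let $1\le r\le s$. Then the functional $$W^{\rm conf}_{n,s,r}=\int_M (Q^{\mathcal F}_r)^{n/r}\,{\rm d}V,\qquad Q^{\mathcal F}_r=\sum_{j=0}^r(-1)^{j+1}C^j_r\,(S^{\mathcal F}_1)^{r-j}S^{\mathcal F}_j,$$ is a conformal invariant of the foliated hypersurface $(M,\mathcal F)$ in $(\bar M,\bar g)$. That is, for every positive function $\mu\in C^3(\bar M)$, the value of $W^{\rm conf}_{n,s,r}$ computed with respect to $\bar g$ equals its value computed with respect to the metric $\bar g^{c}=\mu^2\bar g$.
   Context: $C^j_r=\frac{r!}{j!(r-j)!}$ is a binomial coefficient. For a metric $\bar g$ on $\bar M$: $g$ is the induced metric on $M$, ${\rm d}V$ its volume form, ${\bf N}$ a unit normal field of $M$, $h$ the scalar second fundamental form with respect to ${\bf N}$, and $A$ the Weingarten operator, $g(AX,Y)=h(X,Y)$. $P:TM\to T\mathcal F$ is the $g$-orthogonal projector onto the tangent bundle of the foliation, $h_{\mathcal F}(X,Y)=h(PX,PY)$ is the restriction of $h$ to the leaves, and $A_{\mathcal F}=PAP$ is its dual operator. $\sigma^{\mathcal F}_j$ ($0\le j\le s$, $\sigma^{\mathcal F}_0=1$) are the elementary symmetric functions of the $s$ eigenvalues of $A_{\mathcal F}$ on $T\mathcal F$, and $S^{\mathcal F}_j=\sigma^{\mathcal F}_j/C^j_s$.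 For $\bar g^c=\mu^2\bar g$ the same foliation $\mathcal F$ is used and the unit normal is ${\bf N}/\mu$. The power $(Q^{\mathcal F}_r)^{n/r}$ is understood wherever it is defined. *)

(* Defs.v *)
(* MathComp / MathComp-Analysis *)
From HB Require Import structures.
From mathcomp Require Import all_boot all_order all_algebra.
From mathcomp Require Import all_classical all_reals all_analysis.
Set Implicit Arguments.
Unset Strict Implicit.
Unset Printing Implicit Defensive.
Import Order.TTheory GRing.Theory Num.Theory numFieldNormedType.Exports.
Local Open Scope classical_set_scope.
Local Open Scope ring_scope.

(* Conventions.  Vectors are rows, so a linear map u |-> u *m A acts on the
   right, a bilinear form with matrix B takes the value u *m B *m v^T, and the
   rows of the Jacobian 'J f x are the partial derivatives of f at x. *)

Definition partial (R : realType) (m : nat) (V : normedModType R) (i : 'I_m)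
  (f : 'rV[R]_m -> V) : 'rV[R]_m -> V := fun x => 'D_(delta_mx 0 i) f x.

(* f is of class C^k on U, which is always an open set below *)
Fixpoint Ck (R : realType) (m : nat) (V : normedModType R) (k : nat)
    (U : set 'rV[R]_m) (f : 'rV[R]_m -> V) : Prop :=
  match k with
  | 0%N => forall x, U x -> {for x, continuous f}
  | k'.+1 => (forall x, U x -> differentiable f x) /\
             (forall i : 'I_m, Ck k' U (partial i f))
  end.

(* The Lebesgue integral over R^n of a nonnegative Borel function, as an
   iterated integral (Tonelli); it is only applied to such functions. *)
Fixpoint lebesgue_int (R : realType) (n : nat) :
    ('rV[R]_n -> \bar R) -> \bar R :=
  match n return ('rV[R]_n -> \bar R) -> \bar R with
  | 0%N => fun f => f 0
  | n'.+1 => fun f =>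
      (\int[@lebesgue_measure R]_(x in setT)
         lebesgue_int (fun y : 'rV[R]_n' => f (row_mx (x%:M : 'M[R]_1) y)))%E
  end.

(* Only the values of coord on dom, and of param on img, are meaningful. *)
Record chart (R : realType) (T : topologicalType) (m : nat) := Chart {
  dom : set T;
  coord : T -> 'rV[R]_m;
  param : 'rV[R]_m -> T }.

Section Charts.
Variables (R : realType) (T : topologicalType) (m : nat).
Implicit Types c d : chart R T m.

Definition img c : set 'rV[R]_m := coord c @` dom c.

Definition is_chart c : Prop :=
  [/\ open (dom c), open (img c),
      forall p, dom c p -> param c (coord c p) = p,
      forall p, dom c p -> {for p, continuous (coord c)} &
      forall x, img c x -> {for x, continuous (param c)}].

Definition transition c d : 'rV[R]_m -> 'rV[R]_m := coord d \o param c.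

Definition compatible (k : nat) c d : Prop :=
  Ck k (coord c @` (dom c `&` dom d)) (transition c d) /\
  Ck k (coord d @` (dom c `&` dom d)) (transition d c).
End Charts.

(* C^oo manifolds without boundary.  Each point p has a preferred chart
   chart_at p, and T_pM is R^m by means of the coordinates of that chart. *)
Record manifold (R : realType) (m : nat) := Manifold {
  points :> ptopologicalType;
  atlas : set (chart R points m);
  chart_at : points -> chart R points m;
  manifold_hausdorff : hausdorff_space points;
  manifold_second_countable : @second_countable points;
  atlas_chart : forall c, atlas c -> is_chart c;
  atlas_compatible : forall c d, atlas c -> atlas d ->
    forall k, compatible k c d;
  chart_at_atlas : forall p, atlas (chart_at p);
  chart_at_dom : forall p, dom (chart_at p) p }.
Arguments atlas {R m} _ _.

Section Geometry.
Variables (R : realType) (m : nat) (M : manifold R m).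

Definition coord_at (p : M) : 'rV[R]_m := coord (chart_at p) p.

(* components, in the chart c around p, of v in T_pM *)
Definition vector_in (c : chart R M m) (p : M) (v : 'rV[R]_m) : 'rV[R]_m :=
  v *m 'J (transition (chart_at p) c) (coord_at p).

(* matrix, in the chart c, of a field g of bilinear forms g p on T_pM *)
Definition form_in (c : chart R M m) (g : M -> 'M[R]_m) (x : 'rV[R]_m) :
    'M[R]_m :=
  let J := 'J (transition c (chart_at (param c x))) x in
  J *m g (param c x) *m J^T.

Definition riemannian_metric (g : M -> 'M[R]_m) : Prop :=
  [/\ forall p, (g p)^T = g p,
      forall p (v : 'rV[R]_m), v != 0 -> 0 < (v *m g p *m v^T) 0 0 &
      forall c, atlas M c -> Ck 3 (img c) (form_in c g)].

Definition class_C3 (mu : M -> R) : Prop :=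
  forall c, atlas M c -> Ck 3 (img c) (mu \o param c).

(* christoffel g q a b e is Gamma^e_{ab} at q, in the chart chart_at q; the
   matrix of the metric in that chart at coord_at q is g q *)
Definition christoffel (g : M -> 'M[R]_m) (q : M) (a b e : 'I_m) : R :=
  let dg (i j k : 'I_m) :=
    (partial i (form_in (chart_at q) g) (coord_at q) : 'M[R]_m) j k in
  2^-1 * \sum_(l < m) invmx (g q) e l * (dg a b l + dg b a l - dg l a b).

Definition borel := g_sigma_algebraType (@open M).

(* nu is the Riemannian measure of g: dnu = (det g)^(1/2) dx in every chart *)
Definition riemannian_volume (g : M -> 'M[R]_m)
    (nu : {measure set borel -> \bar R}) : Prop :=
  forall c, atlas M c ->
  forall B : set borel, measurable B -> (B : set M) `<=` dom c ->
    nu B = lebesgue_int (fun x : 'rV[R]_m =>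
      if x \in coord c @` (B : set M)
      then (Num.sqrt (\det (form_in c g x)))%:E else 0%E).

(* An s-dimensional foliation of class C^3, given by foliated charts: the
   plaques are the slices on which the coordinates of index >= s are constant,
   and transition maps locally have the form (x, y) |-> (a(x, y), b(y)). *)
Record foliation (s : nat) := Foliation {
  fatlas : set (chart R M m);
  fchart_at : M -> chart R M m;
  fatlas_chart : forall c, fatlas c -> is_chart c;
  fatlas_compatible : forall c d, fatlas c -> atlas M d -> compatible 3 c d;
  fchart_at_atlas : forall p, fatlas (fchart_at p);
  fchart_at_dom : forall p, dom (fchart_at p) p;
  fatlas_foliated : forall c d, fatlas c -> fatlas d ->
    forall x, (coord c @` (dom c `&` dom d)) x ->
    \forall y \near x & z \near x,
      (forall a : 'I_m, (s <= a)%N ->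
        (y : 'rV[R]_m) 0 a = (z : 'rV[R]_m) 0 a) ->
      forall a : 'I_m, (s <= a)%N ->
        transition c d y 0 a = transition c d z 0 a }.

(* T_pF is the row space of leaf_tangent F p: the span of the first s
   coordinate vectors of a foliated chart around p *)
Definition leaf_tangent (s : nat) (F : foliation s) (p : M) : 'M[R]_m :=
  pid_mx s *m
    'J (transition (fchart_at F p) (chart_at p)) (coord (fchart_at F p) p).

(* g-orthogonal projector onto T_pF: the projection onto T_pF along
   { v | g(v, w) = 0 for all w in T_pF } *)
Definition leaf_projector (s : nat) (F : foliation s) (g : M -> 'M[R]_m)
    (p : M) : 'M[R]_m :=
  proj_mx (leaf_tangent F p) (kermx (g p *m (leaf_tangent F p)^T)).

End Geometry.

Section Hypersurface.
Variables (R : realType) (n : nat) (M : manifold R n) (Mbar : manifold R n.+1).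

Definition local_rep (f : M -> Mbar) (c : chart R M n)
    (d : chart R Mbar n.+1) : 'rV[R]_n -> 'rV[R]_n.+1 :=
  coord d \o f \o param c.

Definition local_dom (f : M -> Mbar) (c : chart R M n)
    (d : chart R Mbar n.+1) : set 'rV[R]_n :=
  coord c @` (dom c `&` f @^-1` dom d).

(* f near p, and the differential T_pM -> T_{f p}Mbar *)
Definition rep_at (f : M -> Mbar) (p : M) : 'rV[R]_n -> 'rV[R]_n.+1 :=
  local_rep f (chart_at p) (chart_at (f p)).

Definition diff_at (f : M -> Mbar) (p : M) : 'M[R]_(n, n.+1) :=
  'J (rep_at f p) (coord_at p).

Definition immersion (f : M -> Mbar) : Prop :=
  [/\ continuous f,
      forall c d, atlas M c -> atlas Mbar d ->
        Ck 3 (local_dom f c d) (local_rep f c d) &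
      forall p, row_free (diff_at f p)].

Definition unit_normal (gbar : Mbar -> 'M[R]_n.+1) (f : M -> Mbar)
    (N : M -> 'rV[R]_n.+1) : Prop :=
  [/\ forall c d, atlas M c -> atlas Mbar d ->
        Ck 2 (local_dom f c d)
          (fun x => vector_in d (f (param c x)) (N (param c x))),
      forall p, (N p *m gbar (f p) *m (N p)^T) 0 0 = 1 &
      forall p, diff_at f p *m gbar (f p) *m (N p)^T = 0].

Definition induced_metric (gbar : Mbar -> 'M[R]_n.+1) (f : M -> Mbar)
    (p : M) : 'M[R]_n :=
  diff_at f p *m gbar (f p) *m (diff_at f p)^T.

(* nabla_{d_i} (df d_j) for the Levi-Civita connection nabla of gbar *)
Definition hessian (gbar : Mbar -> 'M[R]_n.+1) (f : M -> Mbar) (p : M)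
    (i j : 'I_n) : 'rV[R]_n.+1 :=
  partial i (partial j (rep_at f p)) (coord_at p) +
  \row_e \sum_(a < n.+1) \sum_(b < n.+1)
    christoffel gbar (f p) a b e * diff_at f p i a * diff_at f p j b.

(* h(X, Y) = gbar(nabla_X Y, N) *)
Definition second_form (gbar : Mbar -> 'M[R]_n.+1) (f : M -> Mbar)
    (N : M -> 'rV[R]_n.+1) (p : M) : 'M[R]_n :=
  \matrix_(i, j) (hessian gbar f p i j *m gbar (f p) *m (N p)^T) 0 0.

(* g(A X, Y) = h(X, Y) reads A *m g = h *)
Definition weingarten (gbar : Mbar -> 'M[R]_n.+1) (f : M -> Mbar)
    (N : M -> 'rV[R]_n.+1) (p : M) : 'M[R]_n :=
  second_form gbar f N p *m invmx (induced_metric gbar f p).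

Variables (s : nat) (F : foliation M s).

Definition leaf_weingarten (gbar : Mbar -> 'M[R]_n.+1) (f : M -> Mbar)
    (N : M -> 'rV[R]_n.+1) (p : M) : 'M[R]_n :=
  let P := leaf_projector F (induced_metric gbar f) p in
  P *m weingarten gbar f N p *m P.

(* The s eigenvalues, with multiplicity and in some order, of A_F on T_pF;
   they are real because A_F is self-adjoint, so the default is not used. *)
Definition leaf_eigenvalues (gbar : Mbar -> 'M[R]_n.+1) (f : M -> Mbar)
    (N : M -> 'rV[R]_n.+1) (p : M) : 'rV[R]_s :=
  xget 0 [set k : 'rV[R]_s |
    char_poly (restrictmx (leaf_tangent F p) (leaf_weingarten gbar f N p))
    = \prod_(i < s) ('X - (k 0 i)%:P)].

Definition leaf_sigma (gbar : Mbar -> 'M[R]_n.+1) (f : M -> Mbar)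
    (N : M -> 'rV[R]_n.+1) (j : nat) (p : M) : R :=
  \sum_(I : {set 'I_s} | #|I| == j)
    \prod_(i in I) leaf_eigenvalues gbar f N p 0 i.

Definition leaf_S (gbar : Mbar -> 'M[R]_n.+1) (f : M -> Mbar)
    (N : M -> 'rV[R]_n.+1) (j : nat) (p : M) : R :=
  leaf_sigma gbar f N j p / ('C(s, j))%:R.

Definition leaf_Q (gbar : Mbar -> 'M[R]_n.+1) (f : M -> Mbar)
    (N : M -> 'rV[R]_n.+1) (r : nat) (p : M) : R :=
  \sum_(0 <= j < r.+1) (-1) ^+ j.+1 * ('C(r, j))%:R *
    leaf_S gbar f N 1%N p ^+ (r - j) * leaf_S gbar f N j p.

End Hypersurface.

(* The real power x^(n/r), for n, r > 0.  With n/r = a/b in lowest terms it is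
   defined for all real x if b is odd, and for x >= 0 only if b is even; for
   x < 0 and b odd it is (-1)^a |x|^(n/r). *)
Definition rpow_defined (R : realType) (n r : nat) (x : R) : Prop :=
  0 <= x \/ odd (r %/ gcdn n r).

Definition rpow (R : realType) (n r : nat) (x : R) : R :=
  Num.sg x ^+ (n %/ gcdn n r) * powR `|x| (n%:R / r%:R).

(* dV is the Riemannian measure of the induced metric; the integral extends
   over the points where the power is defined *)
Definition Wconf (R : realType) (n s r : nat) (M : manifold R n)
    (Mbar : manifold R n.+1) (f : M -> Mbar) (F : foliation M s)
    (gbar : Mbar -> 'M[R]_n.+1) (N : M -> 'rV[R]_n.+1)
    (dV : {measure set (borel M) -> \bar R}) : \bar R :=
  (\int[dV]_(p in [set p : borel M | rpow_defined n r (leaf_Q F gbar f N r p)])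
     (rpow n r (leaf_Q F gbar f N r p))%:E)%E.

Definition conformal (R : realType) (m : nat) (M : manifold R m) (mu : M -> R)
    (g : M -> 'M[R]_m) : M -> 'M[R]_m :=
  fun q => mu q ^+ 2 *: g q.

(* Main.v *)
Require Import Defs.
From HB Require Import structures.
From mathcomp Require Import all_boot all_order all_algebra.
From mathcomp Require Import all_classical all_reals all_analysis.
From mathcomp Require Import measurable_realfun zify ring lra.
Import Order.TTheory GRing.Theory Num.Theory numFieldNormedType.Exports.
Local Open Scope classical_set_scope.
Local Open Scope ring_scope.
Set Implicit Arguments.
Unset Strict Implicit.
Unset Printing Implicit Defensive.

(** Under the change of metric from gbar to mu^2 gbar, the integrand of the
    functional is divided by mu^n and the volume is multiplied by mu^n.

    The integrand.  The conformal change of the Levi-Civita connection,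
    specialized to a hypersurface, gives A^c = mu^-1 (A - l) for the Weingarten
    operator, where l is the derivative of log mu along the normal N
    (christoffel_conformal, second_form_conformal, weingarten_conformal).  The
    orthogonal projector onto the leaves is the same for both metrics, hence the
    eigenvalues of A_F on the leaves change by k -> mu^-1 (k - l).  Now Q_r is,
    up to a constant, the derivative of order s - r of prod (X - k_i) at the mean
    S_1 of the roots (QrootsE): it is invariant under a translation of the roots
    and homogeneous of degree r (Qroots_affine).  So Q_r is divided by mu^r, and
    its power n/r by mu^n; as mu > 0, the set where the power is defined stays
    the same.

    The volume.  In a chart the density (det g)^(1/2) is multiplied by mu^n.  The
    Lebesgue integral over R^n is an iterated integral here, so its additivity
    is a matter of measurability, but its monotonicity and its homogeneity hold
    for all nonnegative functions.  They yield the one-sided estimates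
    a dV(B) <= dV^c(B) if a <= mu^n on B, and the same with the two metrics
    exchanged (volume_density_le).  Since dV and dV^c are measures, these
    estimates are enough for the change of density dV^c = mu^n dV under the
    integral sign (integral_density).

    The integral is a supremum over simple functions below the integrand, and
    for a measurable positive weight the change of density is compatible with
    this supremum.  It therefore holds for arbitrary functions, of which the power
    of Q_r is one. *)

(** * Elementary symmetric means of the roots of a polynomial *)

Section ElementarySymmetric.
Context {R : comNzRingType} {s : nat}.
Implicit Types k : 'I_s -> R.

Definition elem_sym k (j : nat) : R :=
  \sum_(I : {set 'I_s} | #|I| == j) \prod_(i in I) k i.

Definition root_poly k : {poly R} := \prod_(i < s) ('X - (k i)%:P).

(** Vieta's formula. *)
Lemma root_poly_coef k j : (j <= s)%N ->
  (root_poly k)`_(s - j) = (-1) ^+ j * elem_sym k j.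
Proof.
move=> js; rewrite /root_poly.
under eq_bigr => i _ do rewrite addrC -raddfN/=.
rewrite bigA_distr /= coef_sum mulr_sumr [RHS]big_mkcond /=.
apply: eq_bigr => I _.
rewrite big_if/= big_const iter_mulr_1 -rmorph_prod/= coefCM coefXn.
have -> : (s - j == #|[predC I]|)%N = (#|I| == j).
  have := cardC I; rewrite card_ord => e.
  by apply/eqP/eqP => ?; lia.
by case: ifP => [/eqP <-|_]; rewrite ?mulr1 ?mulr0 // prodrN.
Qed.
End ElementarySymmetric.

Section MeanRoot.
Context {R : numFieldType} {s : nat}.
Implicit Types (k : 'I_s -> R) (c l : R).

Definition elem_mean k j : R := elem_sym k j / ('C(s, j))%:R.

Definition Qroots (r : nat) k : R :=
  \sum_(0 <= j < r.+1) (-1) ^+ j.+1 * ('C(r, j))%:R *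
    elem_mean k 1%N ^+ (r - j) * elem_mean k j.

(** The alternating sum is a Taylor coefficient in disguise.  Differentiating
    the Vieta expansion of P = prod (X - k_i) exactly s - r times multiplies the
    coefficient (-1)^j sigma_j by (s - j)! / (r - j)!, and this number times
    C(s, j) is C(r, j) s! / r!; what remains is, up to sign, the sum defining Q_r
    with X in place of the mean S_1.  In this form the effect of an affine change of the
    roots can be read off, since S_1 moves along with them. *)
Lemma QrootsE r k : (r <= s)%N ->
  Qroots r k
  = - (r`!%:R / s`!%:R) * (root_poly k)^`(s - r).[elem_mean k 1%N].
Proof.
move=> rs; have sz : (size ((root_poly k)^`(s - r)) <= r.+1)%N.
  apply/leq_sizeP => i ri; rewrite coef_derivn nth_default ?mul0rn //.
  rewrite /root_poly size_prod_XsubC /index_enum -enumT size_enum_ord; lia.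
rewrite (horner_coef_wide _ sz) mulr_sumr (reindex_inj rev_ord_inj) /=.
rewrite /Qroots big_mkord; apply: eq_bigr => j _; rewrite !subSS coef_derivn.
have jr : (j <= r)%N by rewrite -ltnS.
have -> : (s - r + (r - j) = s - j)%N by lia.
rewrite root_poly_coef; last lia.
rewrite {2}/elem_mean exprS mulN1r !mulNr; congr (- _).
have fu m : m`!%:R != 0 :> R by rewrite pnatr_eq0 -lt0n fact_gt0.
have binE m i : (i <= m)%N -> 'C(m, i)%:R = m`!%:R / (i`!%:R * (m - i)`!%:R) :> R.
  by move=> im; rewrite -(bin_fact im) !natrM mulfK // mulf_neq0.
rewrite -[(_ * elem_sym k j) *+ _]mulr_natr.
have -> : ((s - j) ^_ (s - r))%:R = (s - j)`!%:R / (r - j)`!%:R :> R.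
  have e : (s - j - (s - r) = r - j)%N by lia.
  have le : (s - r <= s - j)%N by lia.
  by rewrite -(ffact_fact le) natrM e mulfK.
rewrite /(elem_mean k j) !binE //; last lia.
set S := elem_mean k 1 ^+ _; set e := elem_sym k j; set t := (-1) ^+ j.
by field; rewrite ?fu.
Qed.

Lemma elem_mean1_root_poly k : (0 < s)%N -> elem_mean k 1 = - (root_poly k)`_s.-1 / s%:R.
Proof.
move=> s0; rewrite /elem_mean bin1 -subn1 root_poly_coef // expr1 mulN1r opprK //.
Qed.

Lemma elem_mean1_affine k c l : (0 < s)%N ->
  elem_mean (fun i => c * (k i - l)) 1 = c * (elem_mean k 1 - l).
Proof.
move=> s0.
have e1 (h : 'I_s -> R) : elem_sym h 1 = \sum_i h i.
  (* the one-element sets are indexed by their elements; the default value of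
     the inverse map is never taken on such a set *)
  rewrite /elem_sym (reindex_onto (fun i => [set i]%SET)
    (fun I => odflt (Ordinal s0) [pick i in I])) /=.
    apply: eq_big => [i|i _]; last by rewrite big_set1.
    rewrite cards1 /=; case: pickP => [j|/(_ i)]; rewrite finset.inE ?eqxx //.
  move=> I /cards1P[i ->]; case: pickP => [j|/(_ i)]; rewrite finset.inE ?eqxx //.
  by move=> /eqP->.
rewrite /elem_mean !e1 bin1 -mulr_sumr sumrB sumr_const card_ord -[l *+ s]mulr_natr.
field; by rewrite pnatr_eq0 -lt0n.
Qed.

Lemma derivn_comp_affine (p : {poly R}) (a b : R) m :
  (p \Po (a *: 'X + b%:P))^`(m) = a ^+ m *: (p^`(m) \Po (a *: 'X + b%:P)).
Proof.
elim: m => [|m IH]; first by rewrite !derivn0 scale1r.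
rewrite !derivnS IH derivZ deriv_comp derivD derivC addr0 derivZ derivX.
by rewrite exprSr -scalerA alg_polyC mulrC mul_polyC.
Qed.

Lemma root_poly_affine k c l : c != 0 ->
  root_poly (fun i => c * (k i - l))
  = c ^+ s *: (root_poly k \Po (c^-1 *: 'X + l%:P)).
Proof.
move=> c0; rewrite /root_poly rmorph_prod /=.
have -> : c ^+ s = \prod_(i < s) c by rewrite prodr_const card_ord.
rewrite -scaler_prod; apply: eq_bigr => i _.
rewrite comp_polyB comp_polyX comp_polyC scalerBr scalerDr scalerA divff //.
by rewrite -!mul_polyC !rmorphM rmorphB /=; ring.
Qed.

(** A translation of the roots moves P and S_1 together, so Q_r does not see
    it; a dilation by c scales P by c^s and each of the s - r derivatives by
    c^-1. *)
Lemma Qroots_affine k c l r : c != 0 -> (0 < r <= s)%N ->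
  Qroots r (fun i => c * (k i - l)) = c ^+ r * Qroots r k.
Proof.
move=> c0 /andP[r0 rs]; rewrite !QrootsE // elem_mean1_affine; last lia.
rewrite root_poly_affine // derivnZ derivn_comp_affine !hornerZ horner_comp.
have -> : (c^-1 *: 'X + l%:P).[c * (elem_mean k 1 - l)] = elem_mean k 1.
  by rewrite hornerD hornerZ hornerX hornerC mulKf // subrK.
have -> : c ^+ s = c ^+ r * c ^+ (s - r) by rewrite -exprD subnKC.
rewrite exprVn -[c ^+ r * _ * _]mulrA mulVKf ?expf_neq0 //; ring.
Qed.

(** Since the eigenvalues are only known up to order, Q_r has to be recovered
    from the characteristic polynomial alone. *)
Lemma eq_Qroots k k' r : (0 < r <= s)%N ->
  root_poly k = root_poly k' -> Qroots r k = Qroots r k'.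
Proof.
move=> rs kk'; rewrite !QrootsE ?elem_mean1_root_poly ?kk' //; lia.
Qed.
End MeanRoot.

(** * Eigenvalues under an affine change of the matrix *)

Section CharPoly.
Context {F : fieldType}.

Lemma char_poly_affine m (B : 'M[F]_m) (c l : F) : c != 0 ->
  char_poly (c *: (B - l%:M)) = c ^+ m *: (char_poly B \Po (c^-1 *: 'X + l%:P)).
Proof.
move=> c0; rewrite /char_poly -(det_map_mx (comp_poly (c^-1 *: 'X + l%:P))) /=.
rewrite -mul_polyC rmorphXn /= -detZ; congr (\det _); apply/matrixP => i j.
rewrite !mxE comp_polyB comp_polyC.
have cc : c%:P * c^-1%:P = 1 :> {poly F} by rewrite -rmorphM /= divff.
case: (i == j); rewrite ?mulr1n ?mulr0n ?comp_polyX ?comp_poly0 ?subr0.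
  transitivity (c%:P * c^-1%:P * 'X - c%:P * ((B i j)%:P - l%:P)).
    by rewrite cc mul1r polyCM polyCB.
  by rewrite -mul_polyC; ring.
by rewrite polyCM; ring.
Qed.
End CharPoly.

Section Spectrum.
Context {R : numFieldType} {s m : nat}.
Implicit Types (B : 'M[R]_m) (c l : R).

Definition spectrum B : 'rV[R]_s :=
  xget 0 [set k : 'rV[R]_s | char_poly B = \prod_(i < s) ('X - (k 0 i)%:P)].

Lemma spectrum_affine_mem B c l (k : 'rV[R]_s) : c != 0 ->
  char_poly B = root_poly (k 0) ->
  char_poly (c *: (B - l%:M)) = root_poly (fun i => c * (k 0 i - l)).
Proof.
move=> c0 Bk; rewrite char_poly_affine // root_poly_affine // -Bk.
congr (c ^+ _ *: _).
(* a matrix whose characteristic polynomial has s roots has size s *)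
apply/eq_add_S; rewrite -(size_char_poly B) Bk /root_poly size_prod_XsubC.
by rewrite /index_enum -enumT size_enum_ord.
Qed.

(** The eigenvalues of c (B - l) are those of B up to an affine change and up to
    order.  The two characteristic polynomials split together; when they do not,
    both spectra take the default value 0, at which Q_r vanishes. *)
Lemma Qroots_spectrum_affine B c l r : c != 0 -> (0 < r <= s)%N ->
  Qroots r (spectrum (c *: (B - l%:M)) 0) = c ^+ r * Qroots r (spectrum B 0).
Proof.
move=> c0 rs; rewrite /spectrum.
case: xgetP => [k' _ /= Bk'|none'].
  case: xgetP => [k _ /= Bk|none].
    rewrite -(@Qroots_affine _ _ _ _ l) //; apply: eq_Qroots => //.
    by rewrite -(spectrum_affine_mem l c0 Bk) Bk'.
  have c0' : c^-1 != 0 by rewrite invr_eq0.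
  have BE : c^-1 *: (c *: (B - l%:M) - (- (c * l))%:M) = B.
    apply/matrixP => i j; rewrite !mxE.
    by case: (i == j); rewrite ?mulr1n ?mulr0n; field.
  have := spectrum_affine_mem (- (c * l)) c0' Bk'; rewrite BE => e.
  case: (none (\row_i (c^-1 * (k' 0 i - - (c * l))))); rewrite /= e.
  by apply: eq_bigr => i _; rewrite mxE.
case: xgetP => [k _ /= Bk|none].
  have e := spectrum_affine_mem l c0 Bk.
  case: (none' (\row_i (c * (k 0 i - l)))); rewrite /= e.
  by apply: eq_bigr => i _; rewrite mxE.
(* the case of two default values: Qroots_affine at the zero roots, with l = 0 *)
rewrite -(@Qroots_affine _ _ _ _ 0) //; congr Qroots; apply/funext => i.
by rewrite mxE subr0 mulr0.
Qed.
End Spectrum.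

(** * Orthogonal projectors of conformal metrics *)

Section Projector.
Context {R : numFieldType} {n : nat}.

Definition posdef m (g : 'M[R]_m) : Prop :=
  forall v : 'rV[R]_m, v != 0 -> 0 < (v *m g *m v^T) 0 0.

Lemma posdef_unit m (g : 'M[R]_m) : posdef g -> g \in unitmx.
Proof.
move=> gpos; rewrite -row_free_unit; apply: inj_row_free => v vg0.
by apply/eqP; apply: contraT => /gpos; rewrite vg0 mul0mx mxE ltxx.
Qed.

Lemma posdef_pullback m (D : 'M[R]_(n, m)) (g : 'M[R]_m) :
  row_free D -> posdef g -> posdef (D *m g *m D^T).
Proof.
move=> Dfree gpos v v0.
have /gpos : v *m D != 0 by rewrite mulmx_free_eq0.
by rewrite trmx_mul !mulmxA.
Qed.

Definition orthocompl (g L : 'M[R]_n) : 'M[R]_n := kermx (g *m L^T).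

Lemma capmx_orthocompl (g L : 'M[R]_n) : posdef g ->
  (L :&: orthocompl g L = 0)%MS.
Proof.
move=> gpos; apply/eqP; rewrite -submx0; apply/rV_subP => v.
rewrite sub_capmx => /andP[/submxP[u ->] /sub_kermxP uL].
rewrite submx0; apply: contraT => /gpos.
by rewrite trmx_mul mulmxA -[_ *m g *m _]mulmxA uL mul0mx mxE ltxx.
Qed.

Lemma addsmx_orthocompl (g L : 'M[R]_n) : posdef g ->
  row_full (L + orthocompl g L)%MS.
Proof.
move=> gpos; have := mxrank_disjoint_sum (capmx_orthocompl L gpos).
rewrite /row_full => ->; rewrite /orthocompl mxrank_ker.
have -> : \rank (g *m L^T) = \rank L.
  rewrite -[in RHS]mxrank_tr; apply/eqP; rewrite eqn_leq mxrankS ?submxMl //=.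
  rewrite -{1}(mulKmx (posdef_unit gpos) L^T); exact: mxrankS (submxMl _ _).
by rewrite subnKC // rank_leq_col.
Qed.

(** The matrix proj_mx U V is computed by a Gaussian elimination and so depends on
    the matrix V that represents the second subspace.  Only when U and V span
    everything is it determined by the two subspaces. *)
Lemma eq_proj_mx (U V V' : 'M[R]_n) : (U :&: V = 0)%MS -> row_full (U + V)%MS ->
  (V == V')%MS -> proj_mx U V = proj_mx U V'.
Proof.
move=> UV0 UVfull VV'; have UV'0 : (U :&: V' = 0)%MS.
  apply/eqP; rewrite -submx0 -UV0 sub_capmx capmxSl /=.
  by rewrite (submx_trans (capmxSr _ _)) // (eqmxP VV').
rewrite -[RHS]mul1mx -[in RHS](add_proj_mx UV0 (submx_full 1%:M UVfull)).
rewrite mulmxDl !mul1mx [X in _ = X + _]proj_mx_id ?proj_mx_sub //; last first.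
  by rewrite -[proj_mx U V]mul1mx proj_mx_sub.
rewrite [X in _ = _ + X]proj_mx_0 ?addr0 //.
case/andP: VV' => VV' _; apply: submx_trans VV'.
by rewrite -[proj_mx V U]mul1mx proj_mx_sub.
Qed.

Lemma proj_orthocompl_scale (g L : 'M[R]_n) (a : R) : a != 0 -> posdef g ->
  proj_mx L (orthocompl (a *: g) L) = proj_mx L (orthocompl g L).
Proof.
move=> a0 gpos; apply/esym/eq_proj_mx;
  [exact: capmx_orthocompl|exact: addsmx_orthocompl|].
rewrite /orthocompl -scalemxAl; apply/andP; split; apply/sub_kermxP.
  by rewrite -scalemxAr mulmx_ker scaler0.
by rewrite -[X in _ *m X](scalerK a0) -scalemxAr mulmx_ker scaler0.
Qed.

(** P is the identity on the row space of L, so a scalar summand of A survives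
    the compression P A P followed by the restriction to L. *)
Lemma conj_restrict_affine (g L A : 'M[R]_n) (c l : R) : posdef g ->
  let P := proj_mx L (orthocompl g L) in
  conjmx (row_base L) (P *m (c *: (A - l%:M)) *m P)
  = c *: (conjmx (row_base L) (P *m A *m P) - l%:M).
Proof.
move=> gpos P; rewrite /conjmx.
have LP : row_base L *m P = row_base L.
  by rewrite proj_mx_id ?capmx_orthocompl // eq_row_base.
have -> : P *m (c *: (A - l%:M)) *m P = c *: (P *m A *m P - l *: P).
  rewrite -scalemxAr -scalemxAl mulmxBr mulmxBl mul_mx_scalar -scalemxAl.
  by rewrite proj_mx_proj ?capmx_orthocompl.
rewrite -scalemxAr -scalemxAl mulmxBr mulmxBl -scalemxAr LP -scalemxAl.
by rewrite mulmxVp ?row_base_free // scalemx1.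
Qed.
End Projector.

(** * Conformal change of the connection *)

Lemma is_derive_sqrM (R : realType) (V : normedModType R) (k h : V -> R)
    (x v : V) : derivable k x v -> derivable h x v ->
  is_derive x v (fun y => k y ^+ 2 * h y)
    (k x ^+ 2 * 'D_v h x + h x * (2 * k x * 'D_v k x)).
Proof.
move=> /derivableP dk /derivableP dh.
by apply: is_derive_eq; rewrite /GRing.scale /=; ring.
Qed.

Lemma partial_sqrZ (R : realType) (m p : nat) (i : 'I_m) (k : 'rV[R]_m -> R)
    (G : 'rV[R]_m -> 'M[R]_p) (x : 'rV[R]_m) (a b : 'I_p) :
  differentiable k x -> differentiable G x ->
  (partial i (fun y => k y ^+ 2 *: G y) x : 'M[R]_p) a b
  = k x ^+ 2 * (partial i G x : 'M[R]_p) a b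
    + G x a b * (2 * k x * partial i k x).
Proof.
move=> /(@diff_derivable _ _ _ _ _ (delta_mx 0 i)) kd.
move=> /(@diff_derivable _ _ _ _ _ (delta_mx 0 i)) Gd.
have dE a' b' : is_derive x (delta_mx 0 i) (fun y => (k y ^+ 2 *: G y) a' b')
    (k x ^+ 2 * 'D_(delta_mx 0 i) (fun y => G y a' b') x
     + G x a' b' * (2 * k x * 'D_(delta_mx 0 i) k x)).
  have -> : (fun y => (k y ^+ 2 *: G y) a' b')
      = (fun y => k y ^+ 2 * G y a' b').
    by apply/funext => y; rewrite mxE.
  apply: is_derive_sqrM => //.
  by move/derivable_mxP : Gd; apply.
rewrite /partial derive_mx; last first.
  by apply/derivable_mxP => a' b'; case: (dE a' b').
by rewrite derive_mx // !mxE (@derive_val _ _ _ _ _ _ _ (dE a b)).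
Qed.

Section ConformalChange.
Context {R : realType} {m : nat} (M : manifold R m).

Lemma jacobian_transition_self (c : chart R M m) (p : M) :
  atlas M c -> dom c p -> 'J (transition c c) (Defs.coord c p) = 1%:M.
Proof.
move=> Mc cp; have [_ oimg cK _ _] := atlas_chart Mc.
have cimg : img c (Defs.coord c p) by exists p.
have tid : \forall x \near Defs.coord c p, transition c c x = x.
  by apply: filterS (open_nbhs_nbhs (conj oimg cimg)) => _ [q cq <-];
    rewrite /transition /= cK.
have [[dtr _] _] := atlas_compatible Mc Mc 1.
apply/row_matrixP => i; rewrite !rowE mulmx1.
rewrite -deriveEjacobian; last by apply: dtr; exists p.
by rewrite (near_eq_derive _ tid) derive_id.
Qed.

(** T_qM is coordinatized by the preferred chart at q, in which the components of
    a form are therefore its own matrix. *)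
Lemma form_in_self (g : M -> 'M[R]_m) (q : M) :
  form_in (chart_at q) g (coord_at q) = g q.
Proof.
have [_ _ cK _ _] := atlas_chart (chart_at_atlas q).
have cq := chart_at_dom q.
rewrite /form_in /coord_at cK // jacobian_transition_self //.
  by rewrite trmx1 mul1mx mulmx1.
exact: chart_at_atlas.
Qed.

Lemma form_in_conformal (c : chart R M m) (g : M -> 'M[R]_m) (w : M -> R) x :
  form_in c (fun q => w q *: g q) x = w (param c x) *: form_in c g x.
Proof. by rewrite /form_in -scalemxAr -scalemxAl. Qed.

(** The differential of log mu, the only datum of mu that enters the conformal
    change of the connection. *)
Definition dlog (mu : M -> R) (q : M) : 'rV[R]_m :=
  (mu q)^-1 *: \row_i partial i (mu \o param (chart_at q)) (coord_at q).

Lemma partial_form_conformal (g : M -> 'M[R]_m) (mu : M -> R) (q : M) i j k :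
  riemannian_metric g -> class_C3 mu -> 0 < mu q ->
  (partial i (form_in (chart_at q) (conformal mu g)) (coord_at q) : 'M[R]_m) j k
  = mu q ^+ 2 *
    ((partial i (form_in (chart_at q) g) (coord_at q) : 'M[R]_m) j k
     + 2 * dlog mu q 0 i * g q j k).
Proof.
move=> [_ _ gC] muC mu0; have Mc := chart_at_atlas q.
have cq := chart_at_dom q; have [_ _ cK _ _] := atlas_chart Mc.
have [gd _] := gC _ Mc; have [mud _] := muC _ Mc.
have cx : img (chart_at q) (coord_at q) by exists q.
rewrite (funext (form_in_conformal _ _ _)) partial_sqrZ; last 2 first.
- exact: mud.
- exact: gd.
rewrite /= cK // form_in_self /dlog !mxE.
by field; rewrite gt_eqF.
Qed.

End ConformalChange.

Section Christoffel.
Context {R : realType} {m : nat} (M : manifold R m).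

Lemma metric_posdef (g : M -> 'M[R]_m) q : riemannian_metric g -> posdef (g q).
Proof. by case=> _ gpos _ v; exact: gpos. Qed.

(** Koszul's formula at a point, with dG i j k in the role of d_i G_jk.  The
    factor r cancels against the inverse metric, and the terms 2 w_i G_jk coming
    from the differential of the factor are contracted with G^-1. *)
Lemma koszul_conformal (G H : 'M[R]_m) (w : 'rV[R]_m) (r : R)
    (dG dH : 'I_m -> 'I_m -> 'I_m -> R) a b e :
  G^T = G -> G \in unitmx -> r != 0 -> H = r *: G ->
  (forall i j k, dH i j k = r * (dG i j k + 2 * w 0 i * G j k)) ->
  2^-1 * \sum_(l < m) invmx H e l * (dH a b l + dH b a l - dH l a b)
  = 2^-1 * \sum_(l < m) invmx G e l * (dG a b l + dG b a l - dG l a b)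
    + (w 0 a * (b == e)%:R + w 0 b * (a == e)%:R
       - G a b * (w *m invmx G) 0 e).
Proof.
move=> Gsym Gunit r0 -> dHE; set K := invmx G.
have isym : K^T = K by rewrite trmx_inv Gsym.
have invE l : invmx (r *: G) e l = r^-1 * K e l.
  by rewrite invmxZ ?mxE // unitmxZ // unitfE.
have KG c : \sum_(l < m) K e l * G c l = (c == e)%:R.
  have /matrixP/(_ e c) := mulVmx Gunit; rewrite !mxE eq_sym => <-.
  by apply: eq_bigr => l _; congr (_ * _); rewrite -[in LHS]Gsym mxE.
have -> : (w *m K) 0 e = \sum_(l < m) w 0 l * K e l.
  by rewrite mxE; apply: eq_bigr => l _; rewrite -[in RHS]isym [in RHS]mxE.
rewrite -(KG a) -(KG b) !mulr_sumr -big_split -sumrB -big_split /=.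
by apply: eq_bigr => l _; rewrite invE !dHE; field.
Qed.

Lemma christoffel_conformal (g : M -> 'M[R]_m) (mu : M -> R) (q : M) a b e :
  riemannian_metric g -> class_C3 mu -> 0 < mu q ->
  christoffel (conformal mu g) q a b e
  = christoffel g q a b e
    + (dlog mu q 0 a * (b == e)%:R + dlog mu q 0 b * (a == e)%:R
       - g q a b * (dlog mu q *m invmx (g q)) 0 e).
Proof.
move=> gm muC mu0; apply: (koszul_conformal (r := mu q ^+ 2)).
- by case: gm.
- exact/posdef_unit/metric_posdef.
- by rewrite expf_neq0 // gt_eqF.
- by [].
- by move=> i j k; exact: partial_form_conformal.
Qed.
End Christoffel.

(** * Conformal change of the second fundamental form *)

Section Hypersurface.
Context {R : realType} {n : nat} (M : manifold R n) (Mbar : manifold R n.+1).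
Variables (gbar : Mbar -> 'M[R]_n.+1) (f : M -> Mbar) (N : M -> 'rV[R]_n.+1).
Variable (mu : Mbar -> R).
Hypotheses (gm : riemannian_metric gbar) (muC : class_C3 mu).
Hypotheses (mu0 : forall q, 0 < mu q) (fi : immersion f).
Hypothesis (Nn : unit_normal gbar f N).

Lemma induced_conformal p :
  induced_metric (conformal mu gbar) f p = mu (f p) ^+ 2 *: induced_metric gbar f p.
Proof. by rewrite /induced_metric -scalemxAr -scalemxAl. Qed.

Lemma induced_posdef p : posdef (induced_metric gbar f p).
Proof.
case: fi => _ _ ffree; exact: posdef_pullback (ffree p) (metric_posdef _ gm).
Qed.

(** The conformal change of the connection, nabla^c_X Y = nabla_X Y + w(X) Y
    + w(Y) X - g(X, Y) grad(log mu) with w = d(log mu), along the immersion. *)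
Lemma hessian_conformal p i j :
  let D := diff_at f p in
  hessian (conformal mu gbar) f p i j
  = hessian gbar f p i j
    + ((D *m (dlog mu (f p))^T) i 0 *: row j D
       + (D *m (dlog mu (f p))^T) j 0 *: row i D
       - induced_metric gbar f p i j *: (dlog mu (f p) *m invmx (gbar (f p)))).
Proof.
move=> D; rewrite /hessian -addrA -/D; congr (_ + _); apply/rowP => e.
have cE a b := christoffel_conformal a b e gm muC (mu0 (f p)).
have gE : (induced_metric gbar f p) i j
    = \sum_a \sum_b gbar (f p) a b * D i a * D j b.
  rewrite /induced_metric -/D !mxE exchange_big /=.
  apply: eq_bigr => b _; rewrite !mxE mulr_suml; apply: eq_bigr => a _.
  by rewrite ?mxE; ring.
have DE i' : D i' e = \sum_b D i' b * (b == e)%:R.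
  rewrite (bigD1 e) //= eqxx mulr1 big1 ?addr0 // => b /negPf ->; exact: mulr0.
(* the matrices are made opaque, so that mxE expands sums and not Jacobians *)
rewrite {}gE; clearbody D; move: (dlog mu (f p)) cE => w; set W := w *m _.
move=> cE; clearbody W.
have wE i' : (D *m w^T) i' 0 = \sum_a D i' a * w 0 a.
  by rewrite mxE; apply: eq_bigr => a _; rewrite mxE.
rewrite !wE !mxE (DE i) (DE j).
transitivity (\sum_a \sum_b (christoffel gbar (f p) a b e * D i a * D j b
   + (D i a * w 0 a * (D j b * (b == e)%:R)
      + D j b * w 0 b * (D i a * (a == e)%:R)
      - gbar (f p) a b * D i a * D j b * W 0 e))).
  by apply: eq_bigr => a _; apply: eq_bigr => b _; rewrite cE; ring.
under eq_bigr => a _ do rewrite big_split sumrB big_split /=.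
rewrite big_split sumrB big_split /=; congr (_ + (_ + _ - _)).
- by rewrite mulr_suml; apply: eq_bigr => a _; rewrite mulr_sumr.
- rewrite exchange_big mulr_suml; apply: eq_bigr => a _; rewrite mulr_sumr.
  by [].
- rewrite mulr_suml; apply: eq_bigr => a _; rewrite mulr_suml.
  by apply: eq_bigr.
Qed.

Let Nc p := (mu (f p))^-1 *: N p.
Definition normal_dlog p : R := (dlog mu (f p) *m (N p)^T) 0 0.

(** Pairing with the normal kills the two tangential terms of hessian_conformal
    and leaves the normal derivative of log mu; the outer factor is mu^2 from the
    metric times mu^-1 from the unit normal. *)
Lemma second_form_conformal p :
  second_form (conformal mu gbar) f Nc p
  = mu (f p) *: (second_form gbar f N p
                 - normal_dlog p *: induced_metric gbar f p).
Proof.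
case: Nn => _ _ Northo; apply/matrixP => i j.
have m0 : mu (f p) != 0 by rewrite gt_eqF.
have D0 k : (row k (diff_at f p) *m gbar (f p) *m (N p)^T) 0 0 = 0.
  by rewrite -!row_mul Northo row0 mxE.
have GN : (dlog mu (f p) *m invmx (gbar (f p)) *m gbar (f p) *m (N p)^T) 0 0
    = normal_dlog p.
  by rewrite mulmxKV //; exact/posdef_unit/metric_posdef.
have SE gb N' : second_form gb f N' p i j
    = (hessian gb f p i j *m gb (f p) *m (N' p)^T) 0 0 by rewrite mxE.
have RE (c l : R) (A B : 'M[R]_n) :
  (c *: (A - l *: B)) i j = c * (A i j - l * B i j) by rewrite !mxE.
rewrite RE !SE hessian_conformal /conformal.
move: (induced_metric _ _ _) => g; move: (dlog mu (f p)) GN => w GN.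
move: (hessian gbar f p i j) => H.
have -> : (Nc p)^T = (mu (f p))^-1 *: (N p)^T by rewrite linearZ.
rewrite -!scalemxAr -!scalemxAl.
rewrite !mulmxDl !mulNmx -!scalemxAl.
have ZE (a : R) (A : 'M[R]_1) : (a *: A) 0 0 = a * A 0 0 by rewrite mxE.
have DE (A B : 'M[R]_1) : (A + B) 0 0 = A 0 0 + B 0 0 by rewrite mxE.
have NE (A : 'M[R]_1) : (- A) 0 0 = - A 0 0 by rewrite mxE.
by rewrite !ZE !DE NE !ZE !D0 GN; field.
Qed.

(** The Weingarten operator is rescaled and translated by a multiple of the
    identity: conformal maps preserve umbilicity. *)
Lemma weingarten_conformal p :
  weingarten (conformal mu gbar) f Nc p
  = (mu (f p))^-1 *: (weingarten gbar f N p - (normal_dlog p)%:M).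
Proof.
have m0 : mu (f p) != 0 by rewrite gt_eqF.
have U := posdef_unit (induced_posdef p).
rewrite /weingarten second_form_conformal induced_conformal invmxZ; last first.
  by rewrite unitmxZ // unitfE expf_neq0.
rewrite -scalemxAr -scalemxAl mulmxBl -scalemxAl mulmxV // scalemx1 scalerA.
by congr (_ *: _); field.
Qed.
End Hypersurface.

(** * The integrand *)

Section Leaf.
Context {R : realType} {n s : nat} (M : manifold R n) (Mbar : manifold R n.+1).
Variables (F : foliation M s).
Variables (gbar : Mbar -> 'M[R]_n.+1) (f : M -> Mbar) (N : M -> 'rV[R]_n.+1).
Variable (mu : Mbar -> R).
Hypotheses (gm : riemannian_metric gbar) (muC : class_C3 mu).
Hypotheses (mu0 : forall q, 0 < mu q) (fi : immersion f).
Hypothesis (Nn : unit_normal gbar f N).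

(** The projector onto the leaves depends on the conformal class only, hence the
    restriction of A_F to the leaves undergoes the same affine change as A, to
    which Q_r reacts by the factor mu^-r. *)
Lemma leaf_Q_conformal r p : (0 < r <= s)%N ->
  leaf_Q F (conformal mu gbar) f (fun p => (mu (f p))^-1 *: N p) r p
  = (mu (f p))^-1 ^+ r * leaf_Q F gbar f N r p.
Proof.
move=> rs; pose L := leaf_tangent F p.
have m0 : (mu (f p))^-1 != 0 by rewrite invr_eq0 gt_eqF.
have QE gb N' : leaf_Q F gb f N' r p
    = Qroots r (spectrum (s := s)
        (conjmx (row_base L) (leaf_weingarten F gb f N' p)) 0).
  by [].
rewrite !QE -(Qroots_spectrum_affine _ (normal_dlog f N mu p) m0 rs).
congr (Qroots r (spectrum _ 0)).
rewrite /leaf_weingarten /leaf_projector induced_conformal -/L.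
rewrite -/(orthocompl _ _) -/(orthocompl _ _).
rewrite proj_orthocompl_scale ?expf_neq0 ?gt_eqF //; last exact: induced_posdef.
by rewrite weingarten_conformal // conj_restrict_affine //; exact: induced_posdef.
Qed.
End Leaf.

Section Power.
Context {R : realType}.
Implicit Types (n r : nat) (x c : R).

Lemma rpow_defined_scale n r x c : 0 < c ->
  rpow_defined n r (c * x) <-> rpow_defined n r x.
Proof. by move=> c0; rewrite /rpow_defined pmulr_rge0. Qed.

Lemma rpow_scale n r x c : 0 < c -> (0 < r)%N ->
  rpow n r (c ^+ r * x) = c ^+ n * rpow n r x.
Proof.
move=> c0 r0; rewrite /rpow sgrM gtr0_sg ?exprn_gt0 // mul1r.
rewrite normrM (gtr0_norm (exprn_gt0 r c0)) powRM ?normr_ge0 ?exprn_ge0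
  ?(ltW c0) //.
rewrite -(powR_mulrn r (ltW c0)) -powRrM [r%:R * _]mulrCA divff;
  last by rewrite pnatr_eq0 -lt0n.
by rewrite mulr1 powR_mulrn ?ltW // mulrCA.
Qed.
End Power.

(** * Lower integrals and change of density *)

Section LowerIntegral.
Local Open Scope ereal_scope.
Context d (T : measurableType d) (R : realType).
Implicit Types (mu nu : {measure set T -> \bar R}).
Import HBNNSimple.

Lemma le_ge0_integral mu (f g : T -> \bar R) :
  (forall x, 0 <= f x) -> (forall x, f x <= g x) ->
  \int[mu]_x f x <= \int[mu]_x g x.
Proof.
move=> f0 fg; have g0 x : 0 <= g x by apply: le_trans (fg x).
rewrite !ge0_integralTE //; apply: ereal_sup_le => _ [h hf <-].
by exists h => // x; apply: le_trans (fg x).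
Qed.

Lemma sintegral_le_integral mu (h : {nnsfun T >-> R}) (f : T -> \bar R) :
  (forall x, (h x)%:E <= f x) -> sintegral mu h <= \int[mu]_x f x.
Proof.
move=> hf; have f0 x : 0 <= f x by apply: le_trans (hf x); rewrite lee_fin.
by rewrite ge0_integralTE //; apply: ereal_sup_ubound; exists h.
Qed.

Lemma integral_le_bound mu (f : T -> \bar R) (z : \bar R) :
  (forall x, 0 <= f x) ->
  (forall h : {nnsfun T >-> R},
    (forall x, (h x)%:E <= f x) -> sintegral mu h <= z) ->
  \int[mu]_x f x <= z.
Proof.
by move=> f0 hz; rewrite ge0_integralTE //; apply: ge_ereal_sup => _ [h hf <-];
  exact: hz.
Qed.

(** Like the other facts of this section, this one concerns the supremum over
    the simple functions below f, hence arbitrary functions f >= 0. *)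
Lemma ge0_integralZl_any mu (f : T -> \bar R) (c : R) :
  (0 < c)%R -> (forall x, 0 <= f x) ->
  \int[mu]_x (c%:E * f x) = c%:E * \int[mu]_x f x.
Proof.
suff le (g : T -> \bar R) (a : R) : (0 < a)%R -> (forall x, 0 <= g x) ->
    \int[mu]_x (a%:E * g x) <= a%:E * \int[mu]_x g x.
  move=> c0 f0; apply/eqP; rewrite eq_le le //=.
  have ci0 : (0 < c^-1)%R by rewrite invr_gt0.
  have cfi : forall x, 0 <= c%:E * f x.
    by move=> x; rewrite mule_ge0 // lee_fin ltW.
  have := le _ _ ci0 cfi.
  have -> : (fun x => (c^-1)%:E * (c%:E * f x)) = f.
    by apply/funext => x; rewrite muleA -EFinM mulVf ?mul1e // gt_eqF.
  by rewrite -lee_pdivlMl.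
move=> a0 g0; apply: integral_le_bound => [x|h hg].
  by rewrite mule_ge0 // lee_fin ltW.
have ai0 : (0 <= a^-1)%R by rewrite invr_ge0 ltW.
have -> : sintegral mu h = a%:E * sintegral mu (cst a^-1 \* h)%R.
  by rewrite sintegralrM muleA -EFinM divff ?mul1e // gt_eqF.
rewrite lee_pmul2l //; apply: (sintegral_le_integral _ (h := scale_nnsfun h ai0)) => x.
by rewrite /= EFinM lee_pdivrMl.
Qed.

End LowerIntegral.

Lemma measurable_inv_pos d (T : measurableType d) (R : realType) (w : T -> R) :
  (forall x, 0 < w x) -> measurable_fun setT w ->
  measurable_fun setT (fun x => (w x)^-1).
Proof.
move=> w0 mw; have -> : (fun x => (w x)^-1) = (fun x => w x `^ (-1)).
  by apply/funext => x; rewrite powR_inv1 // ltW.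
exact: measurableT_comp (measurable_powR _) mw.
Qed.

Section Density.
Local Open Scope ereal_scope.
Context d (T : measurableType d) (R : realType).
Import HBNNSimple.

(** This says that w dmu <= dnu, in a form that mentions no integral.  It can be
    verified with nothing but the monotonicity of an expression for the two
    measures. *)
Definition density_le (mu nu : {measure set T -> \bar R}) (w : T -> R) :=
  forall A (a : R), measurable A -> (0 <= a)%R -> (forall x, A x -> (a <= w x)%R) ->
  a%:E * mu A <= nu A.

Variables (mu nu : {measure set T -> \bar R}) (w : T -> R).
Hypotheses (w0 : forall x, (0 < w x)%R) (mw : measurable_fun setT w).
Hypothesis (wmunu : density_le mu nu w).

(** On a joint level set where h = x and g = y > 0, the weight w is at least
    x / y. *)
Lemma le_sintegral_density (h g : {nnsfun T >-> R}) :
  (forall x, (h x <= g x * w x)%R) -> sintegral mu h <= sintegral nu g.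
Proof.
move=> hgw; rewrite !sintegralE; set H := range h; set G := range g.
pose ph x := h @^-1` [set x]; pose pg y := g @^-1` [set y].
have -> : \sum_(x \in H) x%:E * mu (h @^-1` [set x])
    = \sum_(x \in H) \sum_(y \in G) x%:E * mu (ph x `&` pg y).
  apply: eq_fsbigr => _ /set_mem [t _ <-].
  by rewrite -ge0_mule_fsumr // additive_nnsfunr nnsfun_cover setIT.
have -> : \sum_(y \in G) y%:E * nu (g @^-1` [set y])
    = \sum_(x \in H) \sum_(y \in G) y%:E * nu (ph x `&` pg y).
  rewrite exchange_fsbig //; apply: eq_fsbigr => _ /set_mem [t _ <-].
  by rewrite -ge0_mule_fsumr // additive_nnsfunl nnsfun_cover setTI.
apply: lee_fsum => // _ [t _ <-]; apply: lee_fsum => // _ [u _ <-].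
have mA : measurable (ph (h t) `&` pg (g u)) by apply: measurableI; exact: measurable_funPTI.
have hAw x : (ph (h t) `&` pg (g u)) x -> (h t <= g u * w x)%R.
  by move=> [<- <-]; exact: hgw.
move: (ph (h t) `&` pg (g u)) mA hAw => A mA hAw.
have [gu0|gu0] := eqVneq (g u) 0%R.
  rewrite gu0 mul0e; have [/set0P[x Ax]|/negPn/eqP ->] := boolP (A != set0).
    have := hAw x Ax; rewrite gu0 mul0r => ht0.
    have -> : h t = 0%R by apply/eqP; rewrite eq_le ht0 /=; exact: fun_ge0.
    by rewrite mul0e.
  by rewrite measure0 mule0.
have gu : (0 < g u)%R by rewrite lt0r gu0 /=; exact: fun_ge0.
rewrite -lee_pdivrMl // muleA -EFinM; apply: wmunu => //.
  by rewrite mulr_ge0 // invr_ge0 ltW.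
by move=> x Ax; rewrite ler_pdivrMl // hAw.
Qed.

(** Let h <= f w be simple.  Simple functions g_n increasing to h / w lie below f;
    le_sintegral_density bounds the integral of g_n w by that of g_n, and
    monotone convergence turns g_n w into h.  As the integral is a supremum over
    simple functions, f itself may be any nonnegative function. *)
Lemma le_integral_density (f : T -> \bar R) : (forall x, 0 <= f x) ->
  \int[mu]_x (f x * (w x)%:E) <= \int[nu]_x f x.
Proof.
move=> f0; apply: integral_le_bound => [x|h hf].
  by rewrite mule_ge0 // lee_fin ltW.
pose k x : \bar R := ((h x / w x)%R)%:E.
have k0 x : 0 <= k x by rewrite lee_fin divr_ge0 // ltW.
have kf x : k x <= f x.
  by rewrite /k EFinM lee_pdivrMr.
have mk : measurable_fun setT k.
  apply/measurable_EFinP; apply: measurable_funM => //.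
  exact: measurable_inv_pos.
pose g := nnsfun_approx measurableT mk.
have gk n x : (g n x)%:E <= k x.
  by rewrite nnsfun_approxE; exact: le_approx.
have gcvg x : (g n x * w x)%:E @[n --> \oo] --> (h x)%:E.
  have -> : (h x)%:E = k x * (w x)%:E by rewrite -EFinM divfK // gt_eqF.
  under eq_fun do rewrite EFinM; apply: cvgeZr => //.
  exact: (cvg_nnsfun_approx measurableT mk (fun x _ => k0 x)).
have -> : sintegral mu h = \int[mu]_x limn (fun n => (g n x * w x)%:E).
  have -> : (fun x => limn (fun n => (g n x * w x)%:E)) = (fun x => (h x)%:E).
    by apply/funext => x; apply/cvg_lim.
  by rewrite integral_nnsfun // patch_setT.
rewrite monotone_convergence //.
- apply: lime_le.
    apply: ereal_nondecreasing_is_cvgn => m n mn; apply: le_ge0_integral => x.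
      by rewrite lee_fin mulr_ge0 // ltW.
    by rewrite lee_fin ler_wpM2r // ?(ltW (w0 x)) //;
      exact/lefP/nd_nnsfun_approx.
  apply: nearW => n; apply: integral_le_bound => [x|h' hg].
    by rewrite lee_fin mulr_ge0 // ltW.
  apply: (@le_trans _ _ (sintegral nu (g n))).
    by apply: le_sintegral_density => x; rewrite -lee_fin hg.
  by apply: sintegral_le_integral => x; apply: le_trans (kf x).
- by move=> n; apply/measurable_EFinP; exact: measurable_funM.
- by move=> n x _; rewrite lee_fin mulr_ge0 // ltW.
- move=> x _ m n mn; rewrite lee_fin ler_wpM2r // ?(ltW (w0 x)) //.
  exact/lefP/nd_nnsfun_approx.
Qed.
End Density.

Section IntegralDensity.
Local Open Scope ereal_scope.
Context d (T : measurableType d) (R : realType).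
Variables (mu nu : {measure set T -> \bar R}) (w : T -> R).
Hypotheses (w0 : forall x, (0 < w x)%R) (mw : measurable_fun setT w).
Hypothesis (wmunu : density_le mu nu w).
Hypothesis (wnumu : density_le nu mu (fun x => (w x)^-1)%R).

(** Both inequalities are instances of le_integral_density: for the weight w and
    the function f / w, and for the weight 1 / w with the measures exchanged. *)
Lemma ge0_integral_density (f : T -> R) : (forall x, (0 <= f x)%R) ->
  \int[nu]_x (f x / w x)%:E = \int[mu]_x (f x)%:E.
Proof.
move=> f0; have fw0 x : (0 <= f x / w x)%R by rewrite divr_ge0 // ltW.
apply/eqP; rewrite eq_le; apply/andP; split.
  under eq_integral => x _ do rewrite EFinM.
  apply: le_integral_density wnumu _ _ => //; last exact: measurable_inv_pos.
  by move=> x; rewrite invr_gt0.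
have -> : \int[mu]_x (f x)%:E = \int[mu]_x ((f x / w x)%:E * (w x)%:E).
  by apply: eq_integral => x _; rewrite -EFinM divfK // gt_eqF.
exact: le_integral_density.
Qed.

Lemma integral_density (D : set T) (f : T -> R) :
  \int[nu]_(x in D) (f x / w x)%:E = \int[mu]_(x in D) (f x)%:E.
Proof.
wlog DT : D f / D = setT => [wlog|].
  rewrite integral_mkcond [RHS]integral_mkcond.
  have -> : (fun x => (f x / w x)%:E) \_ D = (fun x => (((f \_ D) x) / w x)%R%:E).
    by apply/funext => x; rewrite /patch; case: ifP => //; rewrite mul0r.
  have -> : (fun x => (f x)%:E) \_ D = (fun x => ((f \_ D) x)%:E).
    by apply/funext => x; rewrite /patch; case: ifP.
  exact: wlog.
rewrite DT [LHS]integralE [RHS]integralE; congr (_ - _).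
  have -> : (fun x => (f x / w x)%:E)^\+ = (fun x => (Num.max (f x) 0 / w x)%R%:E).
    apply/funext => x; rewrite funeposE -EFin_max; congr (_ %:E).
    by rewrite maxr_pMl ?mul0r // invr_ge0 ltW.
  rewrite ge0_integral_density => [|x]; last by rewrite le_max lexx orbT.
  by apply: eq_integral => x _; rewrite funeposE -EFin_max.
have -> : (fun x => (f x / w x)%:E)^\- = (fun x => (Num.max (- f x) 0 / w x)%R%:E).
  apply/funext => x; rewrite funenegE -EFinN -EFin_max; congr (_ %:E).
  by rewrite maxr_pMl ?mul0r ?mulNr // invr_ge0 ltW.
rewrite ge0_integral_density => [|x]; last by rewrite le_max lexx orbT.
by apply: eq_integral => x _; rewrite funenegE -EFinN -EFin_max.
Qed.
End IntegralDensity.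

Section Localization.
Local Open Scope ereal_scope.

Lemma density_le_cover d (T : measurableType d) (R : realType)
    (mu nu : {measure set T -> \bar R}) (w : T -> R) (U : (set T)^nat) :
  (forall n, measurable (U n)) -> \bigcup_n U n = setT ->
  (forall n A (a : R), measurable A -> A `<=` U n -> (0 <= a)%R ->
     (forall x, A x -> (a <= w x)%R) -> a%:E * mu A <= nu A) ->
  density_le mu nu w.
Proof.
move=> mU UT loc A a mA a0 aw.
pose B n := A `&` seqDU U n.
have mB n : measurable (B n) by apply: measurableI => //; exact: seqDU_measurable.
have tB : trivIset setT B by exact/trivIset_setIl/trivIset_seqDU.
have BA : A = \bigcup_n B n by rewrite -setI_bigcupr -seqDU_bigcup_eq UT setIT.
have mBA : measurable (\bigcup_n B n) by rewrite -BA.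
rewrite BA !measure_semi_bigcup // -nneseriesZl //.
apply: lee_nneseries => n _; first by rewrite mule_ge0.
apply: (loc n) => // [x [_ Ux]|x [Ax _]]; [exact: subset_seqDU Ux|exact: aw].
Qed.

End Localization.

(** * Riemannian volumes of conformal metrics *)

Section LebesgueInt.
Local Open Scope ereal_scope.
Context {R : realType}.

Lemma lebesgue_int_ge0 n (f : 'rV[R]_n -> \bar R) :
  (forall x, 0 <= f x) -> 0 <= lebesgue_int f.
Proof.
elim: n f => [|n IH] f f0 /=; first exact: f0.
by apply: integral_ge0 => x _; exact: IH.
Qed.

Lemma le_lebesgue_int n (f g : 'rV[R]_n -> \bar R) :
  (forall x, 0 <= f x) -> (forall x, f x <= g x) ->
  lebesgue_int f <= lebesgue_int g.
Proof.
elim: n f g => [|n IH] f g f0 fg /=; first exact: fg.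
apply: le_ge0_integral => x; first exact: lebesgue_int_ge0.
exact: IH.
Qed.

Lemma lebesgue_intZl n (f : 'rV[R]_n -> \bar R) (c : R) :
  (0 < c)%R -> (forall x, 0 <= f x) ->
  lebesgue_int (fun x => c%:E * f x) = c%:E * lebesgue_int f.
Proof.
move=> c0; elim: n f => [|n IH] f f0 //=.
rewrite -ge0_integralZl_any // => [|x]; last exact: lebesgue_int_ge0.
by apply: eq_integral => x _; rewrite IH.
Qed.
End LebesgueInt.

Section Volume.
Context {R : realType} {m : nat} (M : manifold R m).

Lemma open_borel (U : set M) : open U -> measurable (U : set (borel M)).
Proof. exact: sub_sigma_algebra. Qed.

Lemma continuous_borel (w : M -> R) :
  continuous w -> measurable_fun setT (w : borel M -> R).
Proof.
move=> /continuousP cw; apply: (measurability _ (RGenOpens.measurableE R)).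
move=> _ [_ [a [b ->] <-]]; rewrite setTI.
apply: open_borel; apply: cw; exact: interval_open.
Qed.

(** The members of a countable basis that lie in a chart.  The basis is given with
    an injection into the natural numbers, so U k is the union of at most one of
    them. *)
Lemma countable_chart_cover : exists U : (set M)^nat,
  [/\ forall k, open (U k), \bigcup_k U k = setT &
      forall k, exists2 c, atlas M c & U k `<=` dom c].
Proof.
have [B /countable_injP[num num_inj] [Bopen Bnbhs]] :=
  @manifold_second_countable _ _ M.
pose B' := [set V | B V /\ exists2 c, atlas M c & V `<=` dom c].
pose U k := \bigcup_(V in [set V | B' V /\ num V = k]) V.
exists U; split=> [k||k].
- by apply: bigcup_open => V [[BV _] _]; exact: Bopen.
- apply/seteqP; split=> // p _.
  have cp := chart_at_dom p; have Mc := chart_at_atlas p.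
  have [odom _ _ _ _] := atlas_chart Mc.
  have [V [BV Vp] Vdom] := Bnbhs p _ (open_nbhs_nbhs (conj odom cp)).
  exists (num V) => //; exists V => //; split=> //; split=> //.
  by exists (chart_at p).
- have [[V [[BV [c Mc Vc]] numV]]|none] := pselect (exists V, B' V /\ num V = k).
    exists c => // p [W [[BW _] numW] Wp]; apply: Vc.
    by rewrite -(num_inj W V) ?inE // numW.
  (* here U k is empty, and any chart will do *)
  exists (chart_at point); first exact: chart_at_atlas.
  by move=> p [W BW _]; case: none; exists W.
Qed.

Lemma C3_continuous (mu : M -> R) : class_C3 mu -> continuous mu.
Proof.
move=> muC p; have cp := chart_at_dom p; have Mc := chart_at_atlas p.
have [odom _ cK ccont _] := atlas_chart Mc.
have [mud _] := muC _ Mc.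
have mux : differentiable (mu \o param (chart_at p)) (Defs.coord (chart_at p) p).
  by apply: mud; exists p.
have : (mu \o param (chart_at p)) \o Defs.coord (chart_at p) @ p -->
    mu (param (chart_at p) (Defs.coord (chart_at p) p)).
  exact: continuous_comp (ccont p cp) (differentiable_continuous mux).
rewrite cK //; apply: cvg_trans; apply: near_eq_cvg.
by apply: filterS (open_nbhs_nbhs (conj odom cp)) => q cq /=; rewrite cK.
Qed.

(** Within one chart both volumes are Lebesgue integrals, whose integrands differ
    by the factor v^m because det(v^2 G) = v^(2m) det G.  Where a <= v^m the
    inequality of the measures thus follows from monotonicity and homogeneity. *)
Lemma volume_density_le (g gc : M -> 'M[R]_m) (v : M -> R)
    (dV dVc : {measure set (borel M) -> \bar R}) :
  (forall p, 0 < v p) -> (forall p, gc p = v p ^+ 2 *: g p) ->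
  riemannian_volume g dV -> riemannian_volume gc dVc ->
  density_le dV dVc (fun p => v p ^+ m).
Proof.
move=> v0 gcE hdV hdVc; have [U [Uo UT Uc]] := countable_chart_cover.
apply: (@density_le_cover _ (borel M) _ _ _ _ U) => // [k|k A a mA AU a0 av].
  exact: open_borel (Uo k).
have [c Mc Ucc] := Uc k; have [_ _ cK _ _] := atlas_chart Mc.
have Ac : (A : set M) `<=` dom c by move=> p /AU /Ucc.
rewrite (hdV _ Mc _ mA Ac) (hdVc _ Mc _ mA Ac).
move: a0; rewrite le_eqVlt => /predU1P[<-|a0].
  by rewrite mul0e; apply: lebesgue_int_ge0 => x; case: ifP => // _; rewrite lee_fin.
rewrite -lebesgue_intZl // => [|x]; last by case: ifP => // _; rewrite lee_fin.
apply: le_lebesgue_int => x.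
  by rewrite mule_ge0 ?lee_fin ?(ltW a0) //; case: ifP => // _; rewrite lee_fin.
case: ifP; last by rewrite mule0.
rewrite inE => -[p Ap <-].
have -> : form_in c gc (Defs.coord c p) = v p ^+ 2 *: form_in c g (Defs.coord c p).
  by rewrite (funext gcE) form_in_conformal cK //; exact: Ac.
have vm0 : 0 <= v p ^+ m by rewrite exprn_ge0 // ltW.
rewrite detZ exprAC sqrtrM ?sqr_ge0 // sqrtr_sqr ger0_norm //.
by rewrite -EFinM lee_fin ler_wpM2r // av.
Qed.
End Volume.

(** The factors v^-n of the integrand and v^n of the measure cancel. *)
Lemma integral_rpow_scale d (T : measurableType d) (R : realType) (n r : nat)
    (nu nuc : {measure set T -> \bar R}) (Q Qc v : T -> R) :
  (0 < r)%N -> (forall p, 0 < v p) -> measurable_fun setT v ->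
  density_le nu nuc (fun p => v p ^+ n) ->
  density_le nuc nu (fun p => (v p)^-1 ^+ n) ->
  (forall p, Qc p = (v p)^-1 ^+ r * Q p) ->
  (\int[nu]_(p in [set p | rpow_defined n r (Q p)]) (rpow n r (Q p))%:E
   = \int[nuc]_(p in [set p | rpow_defined n r (Qc p)]) (rpow n r (Qc p))%:E)%E.
Proof.
move=> r0 v0 mv up down QcE.
have vn0 p : 0 < v p ^+ n by exact: exprn_gt0.
have mvn : measurable_fun setT (fun p => v p ^+ n) by exact: measurable_funX.
have {}down : density_le nuc nu (fun p => (v p ^+ n)^-1).
  by move=> A a mA a0 av; apply: down => // p Ap; rewrite exprVn; exact: av.
rewrite -(integral_density vn0 mvn up down).
have -> : [set p | rpow_defined n r (Qc p)] = [set p | rpow_defined n r (Q p)].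
  apply/funext => p; apply/propext; rewrite /= QcE; apply: rpow_defined_scale.
  by rewrite exprn_gt0 // invr_gt0.
apply: eq_integral => p _; congr (_ %:E).
by rewrite QcE rpow_scale ?invr_gt0 // exprVn mulrC.
Qed.

Unset Implicit Arguments.

Theorem theorem1 (R : realType) (n s r : nat)
  (hn : (2 <= n)%N) (hs : (1 <= s <= n)%N) (hr : (1 <= r <= s)%N)
  (M : manifold R n) (Mbar : manifold R n.+1)
  (gbar : Mbar -> 'M[R]_n.+1) (hgbar : riemannian_metric gbar)
  (f : M -> Mbar) (hf : immersion f)
  (F : foliation M s)
  (N : M -> 'rV[R]_n.+1) (hN : unit_normal gbar f N)
  (mu : Mbar -> R) (hmu : class_C3 mu) (hmu_gt0 : forall q, 0 < mu q)
  (dV dVc : {measure set (borel M) -> \bar R})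
  (hdV : riemannian_volume (induced_metric gbar f) dV)
  (hdVc : riemannian_volume (induced_metric (conformal mu gbar) f) dVc) :
  Wconf r f F gbar N dV
  = Wconf r f F (conformal mu gbar) (fun p => (mu (f p))^-1 *: N p) dVc.
Proof.
have r0 : (0 < r)%N by case/andP: hr.
pose v p := mu (f p); have v0 p : 0 < v p by exact: hmu_gt0.
have vcont : continuous v.
  move=> p; apply: continuous_comp; [by case: hf => + _ _; exact|].
  exact: C3_continuous.
apply: (@integral_rpow_scale _ (borel M) R n r dV dVc _ _ v) => //.
- exact: continuous_borel.
- by apply: volume_density_le hdV hdVc => // p; exact: induced_conformal.
- apply: volume_density_le hdVc hdV => p; first by rewrite invr_gt0.
  by rewrite induced_conformal scalerA -exprMn mulVf ?gt_eqF // expr1n scale1r.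
- by move=> p; exact: (leaf_Q_conformal F hgbar hmu hmu_gt0 hf hN p hr).
Qed.
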